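(* Suppose that the full system $\dot z=f(z,u)$ with $z=(z_1,z_2,z_c)$ decomposes into self-contained subsystems, i.e. it has the form $\dot z_1=f_1(z_1,z_c,u)$, $\dot z_2=f_2(z_2,z_c,u)$, $\dot z_c=f_c(z_c,u)$. Let $t<0$. If the target sets satisfy $\mathcal T=\mathrm{proj}_1^{-1}(\mathcal T_1)\cap \mathrm{proj}_2^{-1}(\mathcal T_2)$, then the minimal backward reachable sets satisfy $$\mathcal A(t)=\mathrm{proj}_1^{-1}(\mathcal A_1(t))\cap \mathrm{proj}_2^{-1}(\mathcal A_2(t)).$$
   Context: System: $z\in\mathbb R^n$ evolves by $\dot z(s)=f(z(s),u(s))$, $s\in[t,0]$, $t<0$, with $u(s)\in\mathcal U$, $\mathcal U\subset\mathbb R^{n_u}$ compact; $f:\mathbb R^n\times\mathcal U\to\mathbb R^n$ is uniformly continuous, bounded, and Lipschitz in $z$ for fixed $u$. Control functions $u(\cdot)$ range over the set $\mathbb U$ of measurable functions $[t,0]\to\mathcal U$. For each $z$ and $u(\cdot)$ let $\zeta(s;z,t,u(\cdot))$, $s\in[t,0]$, be the unique trajectory (satisfying the ODE for almost every $s$) with $\zeta(t;z,t,u(\cdot))=z$. State partition: $z=(z_1,z_2,z_c)$ with $z_i\in\mathbb R^{n_i}$, $z_c\in\mathbb R^{n_c}$, $n_1,n_2>0$, $n_c\ge 0$, $n_1+n_2+n_c=n$. Subsystem states are $x_i=(z_i,z_c)\in\mathbb R^{n_i+n_c}$, $i=1,2$. Subsystem $i$ has dynamics $\dot z_i=f_i(z_i,z_c,u)$,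 $\dot z_c=f_c(z_c,u)$, and its trajectory starting at $x_i$ at time $t$ under $u(\cdot)$ is denoted $\xi_i(s;x_i,t,u(\cdot))$. Back-projection: for $S_i\subseteq\mathbb R^{n_i+n_c}$, $\mathrm{proj}_i^{-1}(S_i)=\{z=(z_1,z_2,z_c)\in\mathbb R^n:(z_i,z_c)\in S_i\}$. Target sets: $\mathcal T\subseteq\mathbb R^n$ (full system), $\mathcal T_i\subseteq\mathbb R^{n_i+n_c}$ (subsystem $i$). Minimal backward reachable sets: $\mathcal A(t)=\{z:\forall u(\cdot)\in\mathbb U,\ \zeta(0;z,t,u(\cdot))\in\mathcal T\}$ and $\mathcal A_i(t)=\{x_i:\forall u(\cdot)\in\mathbb U,\ \xi_i(0;x_i,t,u(\cdot))\in\mathcal T_i\}$.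
   Formalization: ''Lipschitz in z for fixed u'' is taken with one Lipschitz constant valid for all u in U; with a constant depending on u, the trajectory for a measurable control need not be unique, so the reachable sets would be ill-defined. *)

(* Defs.v *)
From mathcomp Require Export all_boot all_order all_algebra.
From mathcomp Require Export all_classical all_reals all_analysis.
From mathcomp Require Export measurable_realfun.
Export Order.TTheory GRing.Theory Num.Theory.
Export numFieldNormedType.Exports.

Set Implicit Arguments.
Unset Strict Implicit.
Unset Printing Implicit Defensive.

Local Open Scope classical_set_scope.
Local Open Scope ring_scope.

Section ControlSystem.
Variables (R : realType) (m nu : nat).
Implicit Types (f : 'rV[R]_m -> 'rV[R]_nu -> 'rV[R]_m) (U : set 'rV[R]_nu).
Implicit Types (t : R) (z : 'rV[R]_m) (u : R -> 'rV[R]_nu) (T : set 'rV[R]_m).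

(* A vector field on R^m x U is a total function, of which only the values at
   (z, u) with u in U matter. R^m carries the (sup) norm of the library. *)

Definition unif_continuous_field U f : Prop :=
  forall e : R, 0 < e -> exists2 d : R, 0 < d &
    forall z z' v v', U v -> U v' -> `|z - z'| < d -> `|v - v'| < d ->
      `|f z v - f z' v'| < e.

Definition bounded_field U f : Prop :=
  exists M : R, forall z v, U v -> `|f z v| <= M.

(* The constant does not depend on the control value: with a constant
   depending on v, trajectories need not be unique. *)
Definition lipschitz_field U f : Prop :=
  exists L : R, forall v, U v -> L.-lipschitz (fun z => f z v).

(* Measurability is Lebesgue measurability: the sigma-algebra on the time axis
   is the completion of the Borel one, that on R^nu is the Borel one. *)
Definition controls U t : set (R -> 'rV[R]_nu) :=
  [set u | (forall s, t <= s <= 0 -> U (u s)) /\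
    measurable_fun
      (`[t, 0] : set (g_sigma_algebraType
                        (completed_algebra_gen (@lebesgue_measure R))))
      (u : _ -> g_sigma_algebraType (@open 'rV[R]_nu))].

Definition abs_continuous (a b : R) (g : R -> 'rV[R]_m) : Prop :=
  forall e : R, 0 < e -> exists2 d : R, 0 < d &
    forall (k : nat) (l r : 'I_k -> R),
      (forall i, a <= l i /\ l i <= r i /\ r i <= b) ->
      trivIset [set: 'I_k] (fun i => `]l i, r i[%classic) ->
      \sum_(i < k) (r i - l i) < d ->
      \sum_(i < k) `|g (r i) - g (l i)| < e.

Definition is_trajectory f u t z (x : R -> 'rV[R]_m) : Prop :=
  [/\ x t = z,
      abs_continuous t 0 x &
      {ae lebesgue_measure, forall s : R,
        t < s < 0 -> is_derive s (1 : R) x (f (x s) (u s))}].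

(* The trajectory of x' = f(x, u) with x(t) = z, by definite description; its
   values outside [t, 0] are irrelevant. The constant function is a default
   for the case where there is no trajectory. *)
Definition trajectory f u t z : R -> 'rV[R]_m :=
  xget (fun=> z) [set x | is_trajectory f u t z x].

Definition min_BRS f U T t : set 'rV[R]_m :=
  [set z | forall u, controls U t u -> T (trajectory f u t z 0)].

End ControlSystem.

Section Subsystems.
Variables (R : realType) (n1 n2 nc nu : nat).

(* The state (z1, z2, zc) is row_mx (row_mx z1 z2) zc. *)

Definition decomposes
    (f : 'rV[R]_(n1 + n2 + nc) -> 'rV[R]_nu -> 'rV[R]_(n1 + n2 + nc))
    (U : set 'rV[R]_nu)
    (f1 : 'rV[R]_n1 -> 'rV[R]_nc -> 'rV[R]_nu -> 'rV[R]_n1)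
    (f2 : 'rV[R]_n2 -> 'rV[R]_nc -> 'rV[R]_nu -> 'rV[R]_n2)
    (fc : 'rV[R]_nc -> 'rV[R]_nu -> 'rV[R]_nc) : Prop :=
  forall z1 z2 zc v, U v ->
    f (row_mx (row_mx z1 z2) zc) v =
      row_mx (row_mx (f1 z1 zc v) (f2 z2 zc v)) (fc zc v).

Definition subsystem (k : nat)
    (g : 'rV[R]_k -> 'rV[R]_nc -> 'rV[R]_nu -> 'rV[R]_k)
    (fc : 'rV[R]_nc -> 'rV[R]_nu -> 'rV[R]_nc)
    (x : 'rV[R]_(k + nc)) (v : 'rV[R]_nu) : 'rV[R]_(k + nc) :=
  row_mx (g (lsubmx x) (rsubmx x) v) (fc (rsubmx x) v).

Definition backproj1 (S1 : set 'rV[R]_(n1 + nc)) : set 'rV[R]_(n1 + n2 + nc) :=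
  [set z | S1 (row_mx (lsubmx (lsubmx z)) (rsubmx z))].

Definition backproj2 (S2 : set 'rV[R]_(n2 + nc)) : set 'rV[R]_(n1 + n2 + nc) :=
  [set z | S2 (row_mx (rsubmx (lsubmx z)) (rsubmx z))].

End Subsystems.

Arguments backproj1 {R n1 n2 nc} S1.
Arguments backproj2 {R n1 n2 nc} S2.

(* Main.v *)
Require Import Defs.
From mathcomp Require Import ring lra.

(** The subsystems being self-contained, the coordinates of a subsystem along a
    trajectory of the full system form a trajectory of that subsystem, under
    the same control. So the full end state lies in the intersection of the
    back-projected targets exactly when the two subsystem end states lie in
    their targets, and quantifying over all controls gives the result: a
    universal quantifier commutes with the conjunction.

    The argument presupposes that the trajectory is well defined, that is, the
    Caratheodory theorem for measurable controls: [trajectory_exists] for the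
    full system and [trajectory_unique] for the subsystems, combined in
    [trajectory_colsub]. Both rest on two facts.

    - [abs_continuous_mean_value]: an absolutely continuous function whose
      derivative is almost everywhere dominated in norm by that of a
      nondecreasing differentiable function [h] has increments at most those
      of [h]. Applied to a difference of Picard steps, with [h] an exponential,
      it shows that the Picard operator halves distances in an exponentially
      weighted sup norm ([picard_step_contraction]). Uniqueness follows at
      once, and existence by iteration.

    - [picard_step_exists]: a Picard step exists for every Lipschitz curve. The
      velocity along the curve is a bounded Lebesgue measurable function of
      time; it is Borel off a null set and its integral is differentiable
      almost everywhere by the Lebesgue differentiation theorem. *)

Set Implicit Arguments.
Unset Strict Implicit.
Unset Printing Implicit Defensive.

Local Open Scope classical_set_scope.
Local Open Scope ring_scope.

(** * Norms, derivatives and the Cousin lemma *)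

Lemma rV_norm_le (R : realType) n (x : 'rV[R]_n) (M : R) :
  0 <= M -> (`|x| <= M <-> forall j, `|x ord0 j| <= M).
Proof.
move=> M0; rewrite [`|x|]/Num.norm /= mx_normrE; split.
  by move=> /bigmax_leP[_ xM] j; exact: (xM (ord0, j)).
by move=> xM; apply/bigmax_leP; split => // -[i j] _ /=; rewrite ord1.
Qed.

Lemma rV_entry_le (R : realType) n (x : 'rV[R]_n) j : `|x ord0 j| <= `|x|.
Proof. exact: (rV_norm_le x (normr_ge0 x)).1. Qed.

(** The linear-approximation form of the derivative: unlike the quotient limit
    it passes to coordinates, and to increments across the base point, by
    mere triangle inequalities. *)
Lemma is_derive_normP (R : realType) (V : normedModType R)
    (x : R -> V) (s : R) (v : V) :
  is_derive s (1 : R) x v <->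
  forall e : R, 0 < e -> exists2 d : R, 0 < d &
    forall y, `|y - s| < d -> `|x y - x s - (y - s) *: v| <= e * `|y - s|.
Proof.
have key (h : R) : h != 0 ->
    `|v - h^-1 *: (x (h *: 1 + s) - x s)| * `|h| =
    `|x (h + s) - x s - h *: v|.
  move=> h0; rewrite -[h *: 1]/(h * 1) mulr1 mulrC -normrZ scalerBr scalerA.
  by rewrite divff// scale1r distrC.
split.
  move=> [dx dxv] e e0.
  have : h^-1 *: (x (h *: 1 + s) - x s) @[h --> (0:R)^'] --> v.
    by rewrite -dxv; exact: dx.
  move=> /cvgrPdist_le /(_ e e0).
  move=> /nbhs_ballP[d /= d0 dP].
  exists d => // y ysd.
  have [->|ys] := eqVneq y s.
    by rewrite !subrr scale0r subrr !normr0 mulr0.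
  have := dP (y - s); rewrite /ball /= sub0r normrN ysd subr_eq0 => /(_ erefl ys).
  move=> /(ler_wpM2r (normr_ge0 (y - s))); rewrite key ?subr_eq0//.
  by rewrite subrK.
move=> H.
have cv : h^-1 *: (x (h *: 1 + s) - x s) @[h --> (0:R)^'] --> v.
  apply/cvgrPdist_le => e e0; have [d d0 dP] := H e e0.
  apply/nbhs_ballP; exists d => //= h; rewrite /ball /= sub0r normrN => hd h0.
  have hn : 0 < `|h| by rewrite normr_gt0.
  by rewrite -(ler_pM2r hn) key//; have := dP (h + s); rewrite addrK; exact.
split; first by apply/cvg_ex; exists v.
exact: cvg_lim cv.
Qed.

(** The Cousin lemma as an induction principle: a property that crosses a
    small enough neighbourhood of every point crosses the whole interval. The
    supremum of the points reached from [a] is itself crossed. It stands for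
    the existence of tagged partitions finer than a given gauge, without
    having to handle partitions. *)
Lemma cousin (R : realType) (P : R -> Prop) (a b : R) : a <= b -> P a ->
  (forall s, a <= s <= b -> exists2 d : R, 0 < d &
    forall x y, a <= x -> x <= s -> s <= y -> y <= b -> s - d < x -> y < s + d ->
      P x -> P y) ->
  P b.
Proof.
move=> ab Pa H.
pose S := [set c | a <= c <= b /\ P c].
have Sa : S a by split => //; rewrite lexx.
have ubS : ubound S b by move=> c [/andP[]].
have hs : has_sup S by split; [exists a|exists b].
have aS : a <= sup S by exact: ub_le_sup hs.2 _ Sa.
have Sb : sup S <= b by apply: ge_sup => //; exists a.
have [d d0 dP] := H (sup S) (introT andP (conj aS Sb)).
have [c [/andP[ac cb] Pc] cd] := sup_adherent d0 hs.
have cS : c <= sup S by apply: ub_le_sup hs.2 _ _; split => //; rewrite ac cb.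
pose y := Num.min b (sup S + d / 2).
have Sy : sup S <= y by rewrite le_min Sb/=; lra.
have yb : y <= b by rewrite ge_min lexx.
have yd : y < sup S + d by rewrite gt_min; apply/orP; right; lra.
have Py := dP c y ac cS Sy yb cd yd Pc.
have yS : y <= sup S.
  by apply: ub_le_sup hs.2 _ _; split => //; rewrite yb (le_trans aS).
suff -> : b = y by [].
by move: yS; rewrite /y minEle; case: ifPn => // _; lra.
Qed.

(** * The mean value inequality for absolutely continuous functions *)

(** Lists of intervals, unlike families indexed by an ordinal, can be built by
    appending one interval at a time, as the Cousin induction requires. *)
Lemma abs_continuous_seq (R : realType) m (a b : R) (w : R -> 'rV[R]_m) :
  abs_continuous a b w -> forall e : R, 0 < e -> exists2 d : R, 0 < d &
    forall s : seq (R * R), all (fun p => (a <= p.1 <= p.2) && (p.2 <= b)) s ->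
      pairwise (fun p q => p.2 <= q.1) s ->
      \sum_(p <- s) (p.2 - p.1) < d ->
      \sum_(p <- s) `|w p.2 - w p.1| < e.
Proof.
move=> acw e e0; have [d d0 dP] := acw e e0; exists d => // s sab sdisj.
rewrite !(big_nth (0, 0)) !big_mkord => slt.
apply: (dP (size s) (fun i => (nth (0, 0) s i).1) (fun i => (nth (0, 0) s i).2)) => //.
  move=> i; move/allP: sab => /(_ _ (mem_nth (0, 0) (ltn_ord i))).
  by move=> /andP[/andP[-> ->] ->].
move: sdisj => /(pairwiseP (0, 0)) sdisj.
have lt_disj (i j : 'I_(size s)) z : (i < j)%N ->
    (nth (0, 0) s i).1 < z < (nth (0, 0) s i).2 ->
    (nth (0, 0) s j).1 < z < (nth (0, 0) s j).2 -> False.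
  move=> ij /andP[_ zi] /andP[jz _].
  have := sdisj i j (ltn_ord i) (ltn_ord j) ij; lra.
move=> i j _ _ [z []]; rewrite /= !in_itv /= => zi zj.
have [ij|ji|/val_inj//] := ltngtP i j.
- by case: (lt_disj i j z).
- by case: (lt_disj j i z).
Qed.

(** Outer regularity of the Lebesgue measure at a set of measure zero. *)
Lemma negligible_open_cover (R : realType) (N : set R) (e : R) :
  (@lebesgue_measure R).-negligible N -> 0 < e ->
  exists G : set R, [/\ open G, N `<=` G & (lebesgue_measure G < e%:E)%E].
Proof.
move=> [A [mA A0 NA]] e0.
have Aoo : (lebesgue_measure A < +oo)%E by rewrite A0.
have [G [oO AO Oe]] := lebesgue_regularity_outer mA Aoo e0.
exists G; split => //; first exact: subset_trans NA AO.
have mO : measurable G by exact: open_measurable.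
have -> := measureDI (@lebesgue_measure R) mO mA.
by rewrite setIidr// [X in (_ + X)%E]A0 adde0.
Qed.

Section mean_value_inequality.
Variables (R : realType) (m : nat) (a b : R) (w : R -> 'rV[R]_m) (h h' : R -> R).
Local Notation mu := (@lebesgue_measure R).

(** Where [w] is differentiable, its increments over short intervals around the
    point are at most those of [h], up to an error proportional to the length.
    The exceptional points are covered by an open set [G] so small that, by
    absolute continuity, disjoint intervals inside [G] carry a total variation
    of [w] below [e]. The Cousin induction carries an inequality at [c] with
    the list of intervals of the second kind met so far; comparing their
    total length with the measure of [G] before [c] keeps it under control. *)
Lemma abs_continuous_mean_value : a <= b -> abs_continuous a b w ->
  (forall x y, a <= x -> x <= y -> y <= b -> h x <= h y) ->
  (forall s, a < s < b -> is_derive s (1 : R) h (h' s)) ->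
  {ae mu, forall s, a < s < b ->
    exists2 v, is_derive s (1 : R) w v & `|v| <= h' s} ->
  `|w b - w a| <= h b - h a.
Proof.
move=> ab acw hle dh dw.
apply/ler_addgt0Pr => eps eps0.
pose e := eps / (b - a + 1).
have ba1 : 0 < b - a + 1 by lra.
have e0 : 0 < e by rewrite divr_gt0.
have eE : e * (b - a) + e = eps by rewrite /e; field; rewrite gt_eqF.
have [d d0 acP] := abs_continuous_seq acw e0.
(* The endpoints, where nothing is known about derivatives, join the
   exceptional set. *)
have [N [negN Na Nb dN]] : exists N : set R, [/\ mu.-negligible N, N a, N b &
    forall s, a <= s <= b -> ~ N s ->
      is_derive s (1 : R) h (h' s) /\
      exists2 v, is_derive s (1 : R) w v & `|v| <= h' s].
  have neg1 (c : R) : mu.-negligible [set c].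
    by apply/negligibleP => //; exact: lebesgue_measure_set1.
  exists (~` [set s | a < s < b ->
     exists2 v, is_derive s (1 : R) w v & `|v| <= h' s] `|` ([set a] `|` [set b])).
  split; [|by right; left|by right; right|].
    by apply: negligibleU => //; exact: negligibleU.
  move=> s /andP[sa sb] Ns.
  have sab : a < s < b.
    rewrite !lt_neqAle sa sb !andbT; apply/andP; split; apply/eqP => es.
      by apply: Ns; right; left; rewrite /= es.
    by apply: Ns; right; right; rewrite /= es.
  split; first exact: dh.
  by apply: contrapT => /= nd; apply: Ns; left => /= /(_ sab).
have [G [oO NO Od]] := negligible_open_cover negN d0.
have mO : measurable G by exact: open_measurable.
pose good c := exists s : seq (R * R),
  [/\ all (fun p => (a <= p.1 <= p.2) && (p.2 <= c)) s,
      pairwise (fun p q => p.2 <= q.1) s,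
      ((\sum_(p <- s) (p.2 - p.1))%:E <= mu (G `&` `]a, c]))%E &
      `|w c - w a| <= h c - h a + e * (c - a) + \sum_(p <- s) `|w p.2 - w p.1|].
suff [s [sab sdisj sO sle]] : good b.
  have : \sum_(p <- s) `|w p.2 - w p.1| < e.
    apply: acP => //; rewrite -lte_fin; apply: (le_lt_trans sO).
    apply: le_lt_trans Od; apply: le_measure; rewrite ?inE//.
    exact: measurableI.
  move: sle; lra.
apply: (@cousin _ good a b ab).
  exists [::]; split => //.
    by rewrite big_nil measure_ge0.
  by rewrite big_nil !subrr normr0 mulr0 !addr0.
move=> s sab; have [Ns|Ns] := pselect (N s).
  (* An exceptional point: the interval to cross lies in G and is recorded. *)
  have /nbhs_ballP[r /= r0 rO] : nbhs s G by apply: open_nbhs_nbhs; split => //; exact: NO.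
  exists r => // x y ax xs sy yb srx ysr.
  have [->//|xy] := eqVneq x y.
  have {}xy : x < y by rewrite lt_neqAle xy (le_trans xs).
  have xyO : `]x, y] `<=` G.
    move=> z /=; rewrite in_itv /= => /andP[xz zy].
    by apply: rO; rewrite /ball /= ltr_distlC; lra.
  move=> [l [lab ldisj lO lle]].
  exists (rcons l (x, y)); split.
  - rewrite all_rcons /= ax (ltW xy) lexx /=.
    by apply: sub_all lab => p /andP[-> /= px]; exact: le_trans (ltW xy).
  - rewrite pairwise_rcons ldisj andbT.
    by apply: sub_all lab => p /andP[_ ].
  - have -> : G `&` `]a, y] = (G `&` `]a, x]) `|` `]x, y].
      apply/seteqP; split => z /=; rewrite !in_itv /=.
        move=> [Oz /andP[az zy]]; have [zx|xz] := leP z x.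
          by left; rewrite az.
        by right; rewrite zy.
      move=> [[Oz /andP[-> zx]]|/andP[xz zy]].
        by split => //=; lra.
      split; first by apply: xyO; rewrite /= in_itv /= xz.
      by lra.
    rewrite measureU//=.
    + rewrite lebesgue_measure_itv /= lte_fin xy.
      by rewrite -cats1 big_cat big_seq1 /= EFinD leeD.
    + exact: measurableI.
    + apply/seteqP; split => z //=; rewrite !in_itv /= => -[[_ ]]; lra.
  - rewrite -cats1 big_cat big_seq1 /=.
    have hxy : h x <= h y by apply: hle => //; exact: ltW.
    have := ler_normD (w y - w x) (w x - w a).
    rewrite addrA subrK => wy.
    have : e * (y - a) = e * (y - x) + e * (x - a) by ring.
    have : 0 <= e * (y - x) by rewrite mulr_ge0//; lra.
    lra.
(* A point of differentiability: half of the error allowance goes to w and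
   half to h. *)
have [dhs [v dws vh]] := dN s sab Ns.
have e20 : 0 < e / 2 by lra.
have [dx1 dx10 H1] := (is_derive_normP _ _ _).1 dhs _ e20.
have [dx2 dx20 H2] := (is_derive_normP _ _ _).1 dws _ e20.
exists (Num.min dx1 dx2); first by rewrite lt_min dx10.
move=> x y ax xs sy yb srx ysr.
have m1 : Num.min dx1 dx2 <= dx1 by rewrite ge_min lexx.
have m2 : Num.min dx1 dx2 <= dx2 by rewrite ge_min lexx orbT.
have ex : `|x - s| = s - x by rewrite ler0_norm ?opprB//; lra.
have ey : `|y - s| = y - s by rewrite ger0_norm//; lra.
have sx : `|x - s| < dx1 /\ `|x - s| < dx2 by rewrite ex; split; lra.
have sy' : `|y - s| < dx1 /\ `|y - s| < dx2 by rewrite ey; split; lra.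
have hx : `|h x - h s - (x - s) * h' s| <= e / 2 * `|x - s| by exact: (H1 x sx.1).
have hy : `|h y - h s - (y - s) * h' s| <= e / 2 * `|y - s| by exact: (H1 y sy'.1).
have wx := H2 x sx.2.
have wy := H2 y sy'.2.
rewrite ex in hx wx; rewrite ey in hy wy.
have wxy : `|w y - w x| <= e / 2 * (y - s) + e / 2 * (s - x) + (y - x) * h' s.
  have -> : w y - w x = (w y - w s - (y - s) *: v) - (w x - w s - (x - s) *: v)
      + (y - x) *: v.
    by apply/rowP => j; rewrite !mxE; ring.
  apply: (le_trans (ler_normD _ _)); apply: lerD.
    by apply: (le_trans (ler_normB _ _)); exact: lerD.
  rewrite normrZ ger0_norm; last by lra.
  by apply: ler_wpM2l => //; lra.
move=> [l [lab ldisj lO lle]].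
exists l; split => //.
- by apply: sub_all lab => p /andP[-> /= px]; lra.
- apply: (le_trans lO); apply: le_measure; rewrite ?inE//.
  + exact: measurableI.
  + exact: measurableI.
  + by apply: setIS; apply: subset_itvl; rewrite bnd_simp; lra.
- have := ler_normD (w y - w x) (w x - w a).
  rewrite addrA subrK => wya.
  move: hx hy; rewrite !ler_norml => /andP[_ hx] /andP[hy _].
  have ? : e / 2 * (s - x) + e/2*(y-s) + e/2 * (y-x) = e * (y - x) by field.
  have : e * (y - a) = e * (y - x) + e * (x - a) by ring.
  have : (y - s) * h' s - (x - s) * h' s = (y - x) * h' s by ring.
  lra.
Qed.
End mean_value_inequality.

(** * Picard iteration: Lipschitz bound, contraction, uniqueness *)

Lemma abs_continuousB (R : realType) m (a b : R) (x y : R -> 'rV[R]_m) :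
  abs_continuous a b x -> abs_continuous a b y ->
  abs_continuous a b (fun s => x s - y s).
Proof.
move=> acx acy e e0; have e20 : 0 < e / 2 by lra.
have [d1 d10 H1] := acx _ e20; have [d2 d20 H2] := acy _ e20.
exists (Num.min d1 d2); first by rewrite lt_min d10.
move=> k l r lr dis; rewrite lt_min => /andP[lt1 lt2].
have := H1 k l r lr dis lt1; have := H2 k l r lr dis lt2.
suff : \sum_(i < k) `|x (r i) - y (r i) - (x (l i) - y (l i))| <=
  \sum_(i < k) `|x (r i) - x (l i)| + \sum_(i < k) `|y (r i) - y (l i)| by lra.
rewrite -big_split /=; apply: ler_sum => i _.
have -> : x (r i) - y (r i) - (x (l i) - y (l i)) =
    (x (r i) - x (l i)) - (y (r i) - y (l i)).
  by apply/rowP => j; rewrite !mxE; ring.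
exact: ler_normB.
Qed.

Lemma abs_continuous_itvS (R : realType) m (a b c d : R) (x : R -> 'rV[R]_m) :
  a <= c -> d <= b -> abs_continuous a b x -> abs_continuous c d x.
Proof.
move=> ac db acx e e0; have [r r0 H] := acx e e0; exists r => // k l u lu.
by apply: H => i; have [? [? ?]] := lu i; split; [|split] => //; lra.
Qed.

Lemma lipschitz_abs_continuous (R : realType) m (a b M : R) (x : R -> 'rV[R]_m) :
  (forall s s', a <= s -> s <= s' -> s' <= b -> `|x s' - x s| <= M * (s' - s)) ->
  abs_continuous a b x.
Proof.
move=> xM e e0; have M1 : 0 < `|M| + 1 by have := normr_ge0 M; lra.
exists (e / (`|M| + 1)); first by rewrite divr_gt0.
move=> k l r lr _; rewrite ltr_pdivlMr// => lte; apply: le_lt_trans lte.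
rewrite mulr_suml; apply: ler_sum => i _; have [al [lri rb]] := lr i.
apply: (le_trans (xM _ _ al lri rb)); rewrite mulrC ler_wpM2l//; first by lra.
by have := ler_norm M; lra.
Qed.

Lemma le0_geometric (R : realType) (r C : R) :
  (forall n, r <= C / 2 ^+ n) -> r <= 0.
Proof.
move=> rC; rewrite leNgt; apply/negP => r0.
have C0 : 0 <= C by have := rC 0%N; rewrite expr0 divr1; lra.
pose k := Num.bound (C / r).
have kC : C / r < k%:R by apply: archi_boundP; rewrite divr_ge0// ltW.
have k2 : k%:R <= 2 ^+ k :> R by rewrite -natrX ler_nat ltnW// ltn_expl.
have := rC k; rewrite leNgt => /negP; apply.
rewrite ltr_pdivrMr ?exprn_gt0// mulrC -ltr_pdivrMr//; exact: lt_le_trans k2.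
Qed.

Lemma lebesgue_ae_filter (R : realType) :
  Filter (almost_everywhere (@lebesgue_measure R)).
Proof. exact: (ae_filter_ringOfSetsType (@lebesgue_measure R)). Qed.
#[local] Hint Extern 0 (Filter (nbhs (almost_everywhere _))) =>
  exact: lebesgue_ae_filter : typeclass_instances.

(** [y] is a value of the Picard operator at [x], in differential form; a
    trajectory is a fixed point of this relation. Stating it without integrals
    lets the mean value inequality do all the estimates. *)
Definition picard_step (R : realType) m nu
    (f : 'rV[R]_m -> 'rV[R]_nu -> 'rV[R]_m) (u : R -> 'rV[R]_nu) (t : R)
    (z : 'rV[R]_m) (x y : R -> 'rV[R]_m) : Prop :=
  [/\ y t = z, abs_continuous t 0 y &
      {ae lebesgue_measure, forall s : R,
        t < s < 0 -> is_derive s (1 : R) y (f (x s) (u s))}].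

Section picard_step.
Variables (R : realType) (m nu : nat) (U : set 'rV[R]_nu).
Variables (f : 'rV[R]_m -> 'rV[R]_nu -> 'rV[R]_m) (u : R -> 'rV[R]_nu) (t : R).
Variables (M L : R).
Hypothesis fM : forall z v, U v -> `|f z v| <= M.
Hypothesis L0 : 0 < L.
Hypothesis fL : forall z z' v, U v -> `|f z v - f z' v| <= L * `|z - z'|.
Hypothesis Uu : forall s, t <= s <= 0 -> U (u s).

Lemma speed_ge0 : t <= 0 -> 0 <= M.
Proof.
move=> t0; have Ut : U (u t) by apply: Uu; rewrite lexx.
exact: le_trans (fM 0 Ut).
Qed.

Lemma picard_step_lipschitz z x y s s' : picard_step f u t z x y ->
  t <= s -> s <= s' -> s' <= 0 -> `|y s' - y s| <= M * (s' - s).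
Proof.
move=> [_ acy dy] ts ss s0.
have M0 : 0 <= M by apply: speed_ge0; lra.
pose h r : R := M * r.
suff : `|y s' - y s| <= h s' - h s by rewrite /h mulrBr.
apply: (@abs_continuous_mean_value _ _ _ _ y h (fun=> M)) => //.
- exact: abs_continuous_itvS acy.
- by move=> a b _ ab _; rewrite ler_wpM2l.
- move=> r _; apply/is_derive_normP => e e0; exists 1 => // r' _.
  rewrite /h; have -> : M * r' - M * r - (r' - r) *: (M : R^o) = 0.
    by rewrite -[_ *: _]/((r' - r) * M); ring.
  by rewrite normr0 mulr_ge0// ltW.
- apply: filterS dy => r dy rs; exists (f (x r) (u r)); first by apply: dy; lra.
  by apply: fM; apply: Uu; lra.
Qed.

(** The exponential weight of Bielecki: for the norm with this weight the Picard
    operator contracts on the whole time interval, however long, so that no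
    subdivision into short intervals is needed. *)
Definition weight s := expR (2 * L * (s - t)).

Lemma weight_ge1 s : t <= s -> 1 <= weight s.
Proof. by move=> ts; rewrite -expR0 ler_expR !mulr_ge0 ?subr_ge0 ?(ltW L0). Qed.

(** The derivative of the difference has norm at most [L * K * weight], which is
    the derivative of [K / 2 * weight]. *)
Lemma picard_step_contraction z x1 x2 y1 y2 (K : R) :
  picard_step f u t z x1 y1 -> picard_step f u t z x2 y2 ->
  (forall s, t <= s <= 0 -> `|x1 s - x2 s| <= K * weight s) ->
  forall s, t <= s <= 0 -> `|y1 s - y2 s| <= K / 2 * weight s.
Proof.
move=> [y1t ac1 d1] [y2t ac2 d2] xK s /andP[ts s0].
have K0 : 0 <= K.
  have := xK s; rewrite ts s0 => /(_ isT).
  by move=> /(le_trans (normr_ge0 _)); rewrite pmulr_lge0// expR_gt0.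
pose h r : R := K / 2 * weight r.
have -> : y1 s - y2 s = (y1 s - y2 s) - (y1 t - y2 t).
  by rewrite y1t y2t subrr subr0.
apply: (@le_trans _ _ (h s - h t)); last first.
  have : 0 <= h t by rewrite mulr_ge0 ?expR_ge0//; lra.
  by rewrite /h; lra.
apply: (@abs_continuous_mean_value _ _ _ _ (fun r => y1 r - y2 r) h
  (fun r => L * (K * weight r))) => //.
- apply: abs_continuousB; first exact: abs_continuous_itvS ac1.
  exact: abs_continuous_itvS ac2.
- move=> a b _ ab _; rewrite /h ler_wpM2l//; first by lra.
  by rewrite ler_expR ler_wpM2l // ?mulr_ge0 ?lerD2r // ltW.
- move=> r _; rewrite /h /weight.
  apply: is_derive_eq.
  by rewrite /GRing.scale /=; field.
- apply: filterS2 d1 d2 => r d1 d2 rs.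
  exists (f (x1 r) (u r) - f (x2 r) (u r)).
    by apply: is_deriveB; [apply: d1|apply: d2]; lra.
  have rt : t <= r <= 0 by lra.
  apply: (le_trans (fL _ _ (Uu rt))).
  by apply: ler_wpM2l; [exact: ltW|exact: xK].
Qed.

(** The distance of two trajectories is bounded, since both are Lipschitz, and
    it is halved by each use of the contraction estimate. *)
Lemma trajectory_unique z x1 x2 :
  is_trajectory f u t z x1 -> is_trajectory f u t z x2 ->
  forall s, t <= s <= 0 -> x1 s = x2 s.
Proof.
move=> X1 X2 s0 ts0.
have step n : forall s, t <= s <= 0 ->
    `|x1 s - x2 s| <= (2 * M * - t) / 2 ^+ n * weight s.
  elim: n => [|n IH] s ts.
    have [x1t _ _] := X1; have [x2t _ _] := X2.
    have := @picard_step_lipschitz z x1 x1 t s X1.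
    have := @picard_step_lipschitz z x2 x2 t s X2.
    rewrite x1t x2t lexx; move: (ts) => /andP[-> ->].
    move=> /(_ isT isT isT) h2 /(_ isT isT isT) h1.
    have M0 : 0 <= M by apply: speed_ge0; lra.
    have h3 : 1 <= weight s by apply: weight_ge1 => //; lra.
    have h4 : M * (s - t) <= M * - t by apply: ler_wpM2l => //; lra.
    have h5 : 0 <= M * - t by apply: mulr_ge0 => //; lra.
    have := ler_normB (x1 s - z) (x2 s - z); rewrite opprB addrA subrK => h6.
    rewrite expr0 divr1; apply: (@le_trans _ _ (2 * M * - t)); first by lra.
    by rewrite ler_peMr//; lra.
  have := picard_step_contraction X1 X2 IH ts.
  by rewrite exprS; congr (_ <= _ * _); field; rewrite expf_neq0//; lra.
apply/eqP; rewrite -subr_eq0 -normr_le0; apply: (@le0_geometric _ _ (2 * M * - t * weight s0)) => n.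
by rewrite mulrAC; exact: step.
Qed.

End picard_step.

(** * Primitives of bounded Lebesgue measurable functions *)

Section lebesgue_measurable.
Variable R : realType.
Local Notation mu := (@lebesgue_measure R).

(** Each superlevel set is Borel up to a null set. Those at rational levels
    determine the function, so that countably many null sets suffice. *)
Lemma lebesgue_measurable_borel_fun (D : set R) (g : R -> R) : measurable D ->
  (forall c, completed_algebra_gen mu (D `&` [set s | c < g s])) ->
  exists B : set R, [/\ measurable B, mu B = 0 &
    measurable_fun (D `\` B) g].
Proof.
move=> mD mg.
have /choice[A /all_and2[mA /choice[N /all_and2[negN AN]]]] : forall q : rat,
    exists A : set R, measurable A /\ exists N : set R, mu.-negligible N /\
      A `|` N = D `&` [set s | ratr q < g s].
  by move=> q; have [A mA [N nN <-]] := mg (ratr q); exists A; split => //; exists N.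
have [enum_rat enum_ratP] : exists e : nat -> option rat,
    forall q, exists n, e n = Some q.
  by exists unpickle => q; exists (pickle q); exact: pickleK.
have : mu.-negligible (\bigcup_n (if enum_rat n is Some q then N q else set0)).
  apply: negligible_bigcup => n; case: (enum_rat n) => [q|].
    exact: negN.
  exact: negligible_set0.
move=> [B [mB B0 NB]].
have {}NB q : N q `<=` B.
  by have [n nq] := enum_ratP q; move=> s Ns; apply: NB; exists n => //; rewrite nq.
exists B; split => //.
move=> mDB; apply: (measurability _ (RGenOInfty.measurableE R)) => //.
move=> /= _ [_ [c ->] <-].
rewrite (_ : _ `&` _ = \bigcup_(q : rat) (if c < ratr q then A q `\` B else set0)).
  by apply: bigcupT_measurable_rat => q; case: ifP => // _; exact: measurableD.
apply/seteqP; split => s /=; rewrite ?in_itv /= ?andbT.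
  move=> [[Ds Bs] cs]; have [q] := rat_in_itvoo cs.
  rewrite in_itv /= => /andP[cq qs]; exists q => //; rewrite cq; split => //.
  have : (D `&` [set s | ratr q < g s]) s by [].
  by rewrite -AN => -[//|/NB].
move=> [q _]; case: ifP => // cq [As Bs].
have : (D `&` [set s | ratr q < g s]) s by rewrite -AN; left.
by move=> [Ds /= qs]; split => //; exact: lt_trans cq qs.
Qed.

(** The primitive is the integral of [g] cut off outside the Borel set on which
    it is Borel measurable; the Lebesgue differentiation theorem
    gives its derivative almost everywhere. *)
Lemma lipschitz_primitive (a b M : R) (g : R -> R) : 0 <= M ->
  (forall c, completed_algebra_gen mu (`[a, b] `&` [set s | c < g s])) ->
  (forall s, a <= s <= b -> `|g s| <= M) ->
  exists G : R -> R,
    (forall s s', s <= s' -> `|G s' - G s| <= M * (s' - s)) /\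
    {ae mu, forall s, a < s < b -> is_derive s (1 : R) G (g s)}.
Proof.
move=> M0 mg gM.
have [B [mB B0 mgB]] := lebesgue_measurable_borel_fun (measurable_itv _) mg.
pose D := `[a, b] `\` B.
have mD : measurable D by exact: measurableD.
pose k := g \_ D.
have kM s : `|k s| <= M.
  rewrite /k patchE; case: ifPn => [|_]; last by rewrite normr0.
  by rewrite inE => -[/= abs _]; apply: gM; rewrite in_itv in abs.
have ik : mu.-integrable setT (EFin \o k).
  rewrite /k -restrict_EFin -integrable_mkcond//.
  apply: measurable_bounded_integrable => //.
    apply: (@le_lt_trans _ _ (mu `[a, b])).
      by apply: le_measure; rewrite ?inE//; exact: subDsetl.
    by rewrite /= lebesgue_measure_itv /=; case: ifP => // _; rewrite ltry.
  exists M; split; first exact: num_real.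
  move=> r Mr s [abs _]; apply: le_trans (ltW Mr); apply: gM.
  by rewrite /= in_itv in abs.
have mE E : measurable E -> mu.-integrable E (EFin \o k).
  by move=> mE; apply: integrableS ik.
exists (fun s => \int[mu]_(r in `]-oo, s]) k r); split.
  move=> s s' ss; rewrite Rintegral_itvB//; last exact: mE.
  apply: (le_trans (le_normr_Rintegral _ _)) => //; first exact: mE.
  have -> : M * (s' - s) = \int[mu]_(r in `]s, s']) M.
    rewrite Rintegral_cst//= lebesgue_measure_itv /= lte_fin.
    case: ltP => [//|s's]; have -> : s' = s by lra.
    by rewrite subrr.
  apply: le_Rintegral => //.
  - exact: integrable_norm (mE _ (measurable_itv _)).
  - apply: measurable_bounded_integrable => //.
      by rewrite /= lebesgue_measure_itv /=; case: ifP => // _; rewrite ltry.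
    by exists M; split; [exact: num_real|move=> r Mr x _; rewrite ger0_norm// ltW].
have loc : locally_integrable setT k by apply: open_integrable_locally => //; exact: openT.
have := FTC1Ny (fun y => mE `]-oo, y]%classic (measurable_itv _)) loc.
have Bneg : {ae mu, forall s, ~ B s}.
  by exists B; split => // s /= /contrapT.
apply: filterS2 Bneg => s Bs [dG Gs] abs; split => //.
rewrite -derive1E Gs /k patchE mem_set//; split => //=.
by rewrite in_itv /=; lra.
Qed.
End lebesgue_measurable.

(** * Existence of trajectories *)

Lemma geometric_cvg (R : realType) m (v : nat -> 'rV[R]_m) (C : R) :
  (forall n, `|v n.+1 - v n| <= C / 2 ^+ n) ->
  exists l : 'rV[R]_m, forall n, `|l - v n| <= 2 * C / 2 ^+ n.
Proof.
move=> vC.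
have C0 : 0 <= C by have := vC 0%N; rewrite expr0 divr1; apply: le_trans.
have vnk n k : `|v (n + k)%N - v n| <= 2 * C / 2 ^+ n - 2 * C / 2 ^+ (n + k).
  elim: k => [|k IH]; first by rewrite addn0 !subrr normr0.
  have := ler_normD (v (n + k).+1 - v (n + k)%N) (v (n + k)%N - v n).
  rewrite addrA subrK addnS => h; apply: (le_trans h).
  have h2 := vC (n + k)%N.
  suff : C / 2 ^+ (n + k) = 2 * C / 2 ^+ (n + k) - 2 * C / 2 ^+ (n + k).+1 by lra.
  by rewrite exprS; field; rewrite expf_neq0// gt_eqF.
have vle n k : `|v (n + k)%N - v n| <= 2 * C / 2 ^+ n.
  apply: (le_trans (vnk n k)); rewrite gerBl divr_ge0 ?exprn_ge0//.
  by rewrite mulr_ge0.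
have small (e : R) : 0 < e -> exists n, 2 * C / 2 ^+ n < e.
  move=> e0; apply: contrapT => /forallNP H.
  suff : e <= 0 by lra.
  by apply: (@le0_geometric _ _ (2 * C)) => n; rewrite leNgt; apply/negP; exact: H.
have : cvg (v @ \oo).
  apply/cauchy_cvgP; apply: cauchy_exP => e e0.
  have [n ne] := small e e0; exists (v n); exists n => // k /= nk.
  rewrite -ball_normE /= distrC -(subnKC nk).
  exact: le_lt_trans (vle _ _) ne.
move=> /cvgrPdist_lt cvl; exists (lim (v @ \oo)) => n.
apply/ler_addgt0Pl => e e0.
have [N _ HN] := cvl e e0.
have := HN (n + N)%N (leq_addl _ _).
have := vle n N.
have := ler_normD (lim (v @ \oo) - v (n + N)%N) (v (n + N)%N - v n).
by rewrite addrA subrK; lra.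
Qed.

Section existence.
Variables (R : realType) (m nu : nat) (U : set 'rV[R]_nu).
Variables (f : 'rV[R]_m -> 'rV[R]_nu -> 'rV[R]_m) (u : R -> 'rV[R]_nu) (t : R).
Variables (M L : R).
Hypothesis fM : forall z v, U v -> `|f z v| <= M.
Hypothesis L0 : 0 < L.
Hypothesis fL : forall z z' v, U v -> `|f z v - f z' v| <= L * `|z - z'|.
Hypothesis fc : unif_continuous_field U f.
Hypothesis cu : controls U t u.
Hypothesis t0 : t <= 0.
Local Notation mu := (@lebesgue_measure R).

Let Uu : forall s, t <= s <= 0 -> U (u s) := cu.1.
Let M0 : 0 <= M := speed_ge0 fM Uu t0.

Let lebesgue_set := g_sigma_algebraType (completed_algebra_gen mu).

(** For a fixed state, the continuity of the field on [U] writes the set as the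
    preimage under the control of an open set. *)
Lemma control_superlevel_measurable z j c :
  measurable ([set s | t <= s <= 0 /\ c < f z (u s) ord0 j] : set lebesgue_set).
Proof.
pose W := \bigcup_(p in [set p : 'rV[R]_nu * R | 0 < p.2 /\
   forall v, U v -> ball p.1 p.2 v -> c < f z v ord0 j]) ball p.1 p.2.
have oW : open W by apply: bigcup_open => -[v d] _; exact: ball_open.
have mI : measurable (`[t, 0]%classic : set lebesgue_set).
  apply: sub_sigma_algebra; exists `[t, 0]%classic => //.
  by exists set0; [exact: negligible_set0|rewrite setU0].
have mW : measurable (W : set (g_sigma_algebraType (@open 'rV[R]_nu))).
  exact: sub_sigma_algebra.
have := cu.2 mI W mW; congr measurable; apply/seteqP; split => s /=.
  move=> [+ [[v d] [/= d0 vP] us]]; rewrite in_itv /= => ts; split => //.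
  exact: vP (Uu ts) us.
move=> [ts cs]; rewrite in_itv /=; split => //.
have e0 : 0 < f z (u s) ord0 j - c by lra.
have [d d0 dP] := fc e0.
exists (u s, d); last exact: ballxx.
split => //= v Uv; rewrite -ball_normE /= => vd.
have := dP z z _ _ (Uu ts) Uv; rewrite subrr normr0 => /(_ d0 vd).
have := rV_entry_le (f z (u s) - f z v) j; rewrite !mxE.
have := ler_norm (f z (u s) ord0 j - f z v ord0 j); lra.
Qed.

(** The state is frozen at rational times: [f (x s) (u s)] exceeds [c] exactly
    when, for some rational [q] close to [s], [f (x q) (u s)] exceeds [c] by
    more than the oscillation that the Lipschitz bounds allow between the two
    times. This is a countable union of sets with frozen state. *)
Lemma field_along_measurable (x : R -> 'rV[R]_m) j c :
  (forall s s', `|x s - x s'| <= M * `|s - s'|) ->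
  completed_algebra_gen mu (`[t, 0] `&` [set s | c < f (x s) (u s) ord0 j]).
Proof.
move=> xM; rewrite -g_sigma_completed_algebra_genE.
have fx s r : t <= s <= 0 ->
    `|f (x s) (u s) ord0 j - f (x r) (u s) ord0 j| <= L * M * `|s - r|.
  move=> ts; have := rV_entry_le (f (x s) (u s) - f (x r) (u s)) j; rewrite !mxE.
  move=> /le_trans; apply; apply: (le_trans (fL _ _ (Uu ts))).
  by rewrite -mulrA ler_wpM2l// ltW.
have [r [r0 rP]] : exists r : nat -> R,
    (forall k, 0 < r k) /\ (forall e, 0 < e -> exists k, r k < e).
  exists (fun k => k.+1%:R^-1); split => [k|e e0]; first by rewrite invr_gt0.
  by have [k] := ltr_add_invr (y := 0) e0; rewrite add0r; exists k.
pose F k (q : rat) : set R := `](ratr q - r k), (ratr q + r k)[ `&`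
  [set s | t <= s <= 0 /\ c + L * M * r k < f (x (ratr q)) (u s) ord0 j].
have -> : `[t, 0] `&` [set s | c < f (x s) (u s) ord0 j] = \bigcup_k \bigcup_q F k q.
  apply/seteqP; split => s /=.
    rewrite in_itv /= => -[ts cs].
    have LM : 0 <= L * M by rewrite mulr_ge0// ltW.
    (* Twice the oscillation: once for freezing the state, once for the margin
       that the definition of F demands. *)
    have [k] : exists k : nat, L * M * r k * 2 < f (x s) (u s) ord0 j - c.
      have e0 : 0 < (f (x s) (u s) ord0 j - c) / (L * M * 2 + 1).
        by rewrite divr_gt0//; lra.
      have [k kP] := rP _ e0; exists k.
      by move: kP (r0 k); rewrite ltr_pdivlMr; lra.
    move=> kP; exists k => //.
    have k0 := r0 k.
    have [q] : exists q : rat, ratr q \in `]s, (s + r k)[.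
      by apply: rat_in_itvoo; lra.
    rewrite in_itv /= => sq; exists q => //; split => /=.
      by rewrite in_itv /=; lra.
    split => //.
    have := fx s (ratr q) ts.
    have : L * M * `|s - ratr q| <= L * M * r k.
      by rewrite ler_wpM2l// ler0_norm; lra.
    have := ler_norm (f (x s) (u s) ord0 j - f (x (ratr q)) (u s) ord0 j).
    by lra.
  move=> [k _ [q _ [/= + [ts cs]]]]; rewrite !in_itv /= => sq; split => //.
  have LM : 0 <= L * M by rewrite mulr_ge0// ltW.
  have := fx s (ratr q) ts.
  have : L * M * `|s - ratr q| <= L * M * r k.
    by rewrite ler_wpM2l// ler_norml; lra.
  have := ler_norm (f (x (ratr q)) (u s) ord0 j - f (x s) (u s) ord0 j).
  by rewrite distrC; lra.
apply: (@bigcupT_measurable _ lebesgue_set) => k.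
apply: (@bigcupT_measurable_rat _ lebesgue_set) => q.
apply: (@measurableI _ lebesgue_set); last exact: control_superlevel_measurable.
apply: sub_sigma_algebra; exists `](ratr q - r k), (ratr q + r k)[%classic.
  exact: measurable_itv.
by exists set0; [exact: negligible_set0|rewrite setU0].
Qed.

(** The Lipschitz bound is asked of [x] and given for [y] on the whole line, so
    that the construction can be iterated. *)
Lemma picard_step_exists z (x : R -> 'rV[R]_m) :
  (forall s s', `|x s - x s'| <= M * `|s - s'|) ->
  exists2 y : R -> 'rV[R]_m, picard_step f u t z x y &
    forall s s', `|y s - y s'| <= M * `|s - s'|.
Proof.
move=> xM.
have /choice[G /all_and2[GM dG]] : forall j, exists G : R -> R,
    (forall s s', s <= s' -> `|G s' - G s| <= M * (s' - s)) /\
    {ae mu, forall s, t < s < 0 -> is_derive s (1 : R) G (f (x s) (u s) ord0 j)}.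
  move=> j; apply: lipschitz_primitive => //.
    by move=> c; exact: field_along_measurable.
  by move=> s ts; apply: (le_trans (rV_entry_le _ _)); exact: fM (Uu ts).
pose y s : 'rV[R]_m := z + \row_j (G j s - G j t).
have yM s s' : s <= s' -> `|y s' - y s| <= M * (s' - s).
  move=> ss; apply/rV_norm_le; first by rewrite mulr_ge0//; lra.
  move=> j; rewrite !mxE.
  have -> : z ord0 j + (G j s' - G j t) - (z ord0 j + (G j s - G j t)) =
    G j s' - G j s by ring.
  exact: GM.
exists y; last first.
  move=> s s'; have [ss|/ltW ss] := leP s s'.
    by rewrite distrC (distrC s) (ger0_norm (_ : 0 <= s' - s)) ?yM//; lra.
  by rewrite (ger0_norm (_ : 0 <= s - s')) ?yM//; lra.
split.
- by apply/rowP => j; rewrite !mxE subrr addr0.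
- by apply: lipschitz_abs_continuous => s s' _ ss _; exact: yM.
have : {ae mu, forall s, forall j, t < s < 0 ->
    is_derive s (1 : R) (G j) (f (x s) (u s) ord0 j)}.
  by apply: (@filter_forall _ _ (fun j s => t < s < 0 ->
    is_derive s (1 : R) (G j) (f (x s) (u s) ord0 j)) _ (@lebesgue_ae_filter R)).
apply: filterS => s dGs ts; apply/is_derive_normP => e e0.
have /choice[d /all_and2[d0 dP]] : forall j, exists d : R, 0 < d /\
    forall r, `|r - s| < d -> `|G j r - G j s - (r - s) * f (x s) (u s) ord0 j| <= e * `|r - s|.
  move=> j; have [d d0 dP] := (is_derive_normP _ _ _).1 (dGs j ts) e e0.
  by exists d; split => // r rs; exact: (dP r rs).
exists (\big[Num.min/1]_j d j).
  by apply: lt_bigmin => // j _; exact: d0.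
move=> r rs; apply/rV_norm_le; first by rewrite mulr_ge0// ltW.
move=> j; rewrite !mxE.
have -> : z ord0 j + (G j r - G j t) - (z ord0 j + (G j s - G j t)) -
  (r - s) * f (x s) (u s) ord0 j = G j r - G j s - (r - s) * f (x s) (u s) ord0 j.
  by ring.
by apply: dP; apply: (lt_le_trans rs); exact: bigmin_le_cond.
Qed.

(** The Picard iterates converge geometrically in the weighted norm to some
    [X]. The trajectory is not [X] itself, about whose derivative the limit
    says nothing, but a Picard step [y] of [X]: by contraction [y] is the limit of
    the iterates too, so it agrees with [X] on the time interval. *)
Lemma trajectory_exists z : exists x, is_trajectory f u t z x.
Proof.
pose Lip (x : R -> 'rV[R]_m) := forall s s', `|x s - x s'| <= M * `|s - s'|.
have /choice[P PP] : forall x, exists y, Lip x -> picard_step f u t z x y /\ Lip y.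
  move=> x; have [xM|nx] := pselect (Lip x); last by exists x.
  by have [y xy yM] := picard_step_exists z xM; exists y.
pose x n := iter n P (fun=> z).
have xL n : Lip (x n).
  elim: n => [|n IH]; first by move=> s s'; rewrite subrr normr0 mulr_ge0.
  exact: (PP _ IH).2.
have xP n : picard_step f u t z (x n) (x n.+1) := (PP _ (xL n)).1.
pose w := weight t L.
pose K := M * - t.
have t_le0 := t0.
have K0 : 0 <= K by rewrite mulr_ge0//; lra.
have xK n : forall s, t <= s <= 0 -> `|x n.+1 s - x n s| <= K / 2 ^+ n * w s.
  elim: n => [|n IH] s ts.
    have [x1t _ _] := xP 0%N.
    have := xL 1%N s t; rewrite x1t expr0 divr1 => h.
    apply: (le_trans h); rewrite ger0_norm; last by lra.
    have w1 : 1 <= w s.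
      by apply: weight_ge1 => //; lra.
    apply: (@le_trans _ _ K); first by apply: ler_wpM2l => //; lra.
    by rewrite ler_peMr//; lra.
  have := picard_step_contraction L0 fL Uu (xP n.+1) (xP n) IH ts.
  by rewrite exprS; congr (_ <= _ * _); field; rewrite expf_neq0// gt_eqF.
have wle s : t <= s <= 0 -> w s <= w 0.
  by move=> ts; rewrite ler_expR ler_wpM2l// ?mulr_ge0 ?(ltW L0)//; lra.
(* The iterates converge on the time interval only; clamping the time extends
   the limit to a Lipschitz function on the line. *)
pose clamp (s : R) := Num.max t (Num.min s 0).
have clampP s : t <= clamp s <= 0.
  by rewrite /clamp maxEle minEle; case: ifP; case: ifP; lra.
have clamp_id s : t <= s <= 0 -> clamp s = s.
  by rewrite /clamp maxEle minEle; case: ifP; case: ifP; lra.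
have clampL s s' : `|clamp s - clamp s'| <= `|s - s'|.
  rewrite /clamp !maxEle !minEle ler_norml; have := ler_norm (s - s').
  have := ler_norm (s' - s); rewrite (distrC s').
  by do 4 case: ifP; lra.
have /choice[X XP] : forall s, exists l, forall n,
    `|l - x n (clamp s)| <= 2 * (K * w 0) / 2 ^+ n.
  move=> s; apply: geometric_cvg => n.
  apply: (le_trans (xK n _ (clampP s))).
  rewrite mulrAC ler_wpM2r ?invr_ge0 ?exprn_ge0// ler_wpM2l//.
  exact: wle.
pose C := 2 * (K * w 0).
have C_ge0 : 0 <= C by rewrite mulr_ge0 ?(mulr_ge0 K0)//; exact: expR_ge0.
have XL : Lip X.
  move=> s s'; rewrite -subr_le0.
  apply: (@le0_geometric _ _ (2 * C)) => n.
  have := XP s n; have := XP s' n; rewrite -/C.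
  have : M * `|clamp s - clamp s'| <= M * `|s - s'| by rewrite ler_wpM2l.
  have := xL n (clamp s) (clamp s').
  have : `|X s - X s'| <= `|X s - x n (clamp s)| + `|x n (clamp s) - x n (clamp s')|
      + `|X s' - x n (clamp s')|.
    rewrite (distrC (X s')).
    have -> : X s - X s' = (X s - x n (clamp s)) +
        (x n (clamp s) - x n (clamp s')) + (x n (clamp s') - X s').
      by rewrite !addrA !subrK.
    by apply: (le_trans (ler_normD _ _)); rewrite lerD2r ler_normD.
  rewrite -mulrA; lra.
have [y Xy yL] := picard_step_exists z XL.
have yX s : t <= s <= 0 -> y s = X s.
  move=> ts; apply/eqP; rewrite -subr_eq0 -normr_le0.
  apply: (@le0_geometric _ _ (C * w 0)) => n.
  have Xx r : t <= r <= 0 -> `|X r - x n r| <= C / 2 ^+ n * w r.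
    move=> tr; have := XP r n; rewrite clamp_id// => h; apply: (le_trans h).
    rewrite ler_peMr//.
      by rewrite divr_ge0 ?exprn_ge0.
    by apply: weight_ge1 => //; lra.
  have h1 := picard_step_contraction L0 fL Uu Xy (xP n) Xx ts.
  have h2 := XP s n.+1; rewrite clamp_id// -/C in h2.
  have C0 : 0 <= C / 2 ^+ n.
    by rewrite divr_ge0 ?exprn_ge0.
  have w1 : 1 <= w 0.
    by apply: weight_ge1 => //; lra.
  have h3 : C / 2 ^+ n.+1 = C / 2 ^+ n / 2.
    by rewrite exprS; field; rewrite expf_neq0// gt_eqF.
  have h4 : C / 2 ^+ n / 2 * w s <= C / 2 ^+ n / 2 * w 0.
    by rewrite ler_wpM2l ?wle//; lra.
  have h5 : C / 2 ^+ n / 2 <= C / 2 ^+ n / 2 * w 0.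
    by rewrite ler_peMr//; lra.
  have := ler_normD (y s - x n.+1 s) (x n.+1 s - X s).
  rewrite addrA subrK (distrC (x n.+1 s)) [C * w 0 / _]mulrAC.
  rewrite h3 in h2.
  move: h1 h2 h4 h5; rewrite -/w; move: (C / 2 ^+ n) => D; lra.
exists y; have [yt acy dy] := Xy; split => //.
apply: filterS dy => s dy ts; rewrite yX; last by lra.
exact: dy.
Qed.

End existence.

(** * Coordinate projections of trajectories *)

Section coordinate_projection.
Variables (R : realType) (m k nu : nat) (sigma : 'I_k -> 'I_m).

Lemma colsub_norm_le (x : 'rV[R]_m) : `|colsub sigma x| <= `|x|.
Proof. by apply/rV_norm_le => // j; rewrite mxE rV_entry_le. Qed.

Lemma is_derive_colsub (x : R -> 'rV[R]_m) (s : R) (v : 'rV[R]_m) :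
  is_derive s (1 : R) x v ->
  is_derive s (1 : R) (fun r => colsub sigma (x r)) (colsub sigma v).
Proof.
move=> /is_derive_normP dx; apply/is_derive_normP => e /dx[d d0 dP].
exists d => // r /dP; apply: le_trans.
have -> : colsub sigma (x r) - colsub sigma (x s) - (r - s) *: colsub sigma v =
  colsub sigma (x r - x s - (r - s) *: v) by apply/rowP => j; rewrite !mxE.
exact: colsub_norm_le.
Qed.

Lemma abs_continuous_colsub (a b : R) (x : R -> 'rV[R]_m) :
  abs_continuous a b x -> abs_continuous a b (fun r => colsub sigma (x r)).
Proof.
move=> acx e /acx[d d0 dP]; exists d => // n l r lr dis /(dP _ _ _ lr dis).
apply: le_lt_trans; apply: ler_sum => i _.
have -> : colsub sigma (x (r i)) - colsub sigma (x (l i)) =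
  colsub sigma (x (r i) - x (l i)) by apply/rowP => j; rewrite !mxE.
exact: colsub_norm_le.
Qed.

(** An isometric section of the projection: it lets the projected field inherit
    the bounds of the full one. *)
Definition zero_extend (x : 'rV[R]_k) : 'rV[R]_m :=
  \row_i (if [pick j | sigma j == i] is Some j then x ord0 j else 0).

Lemma colsub_zero_extend x : injective sigma -> colsub sigma (zero_extend x) = x.
Proof.
move=> inj; apply/rowP => j; rewrite !mxE; case: pickP => [i /eqP/inj -> //|].
by move=> /(_ j); rewrite eqxx.
Qed.

Lemma zero_extend_dist x y : `|zero_extend x - zero_extend y| <= `|x - y|.
Proof.
apply/rV_norm_le => // i; rewrite !mxE; case: pickP => [j _|_].
  by have := rV_entry_le (x - y) j; rewrite !mxE.
by rewrite subrr normr0.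
Qed.

Variables (U : set 'rV[R]_nu) (f : 'rV[R]_m -> 'rV[R]_nu -> 'rV[R]_m).
Variables (g : 'rV[R]_k -> 'rV[R]_nu -> 'rV[R]_k).

(** The projection of a trajectory solves the projected equation, hence is its
    only trajectory. Existence upstairs matters: trajectories being
    defined by description, the identity would fail for a subsystem that
    had a trajectory while the full system had none. *)
Lemma trajectory_colsub (t : R) (u : R -> 'rV[R]_nu) (z : 'rV[R]_m) :
  t <= 0 -> unif_continuous_field U f -> bounded_field U f ->
  lipschitz_field U f -> injective sigma ->
  (forall y v, U v -> colsub sigma (f y v) = g (colsub sigma y) v) ->
  controls U t u ->
  colsub sigma (trajectory f u t z 0) = trajectory g u t (colsub sigma z) 0.
Proof.
move=> t0 fc [M fM] [L' fL'] inj fg cu.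
pose L := `|L'| + 1.
have L0 : 0 < L by rewrite /L; have := normr_ge0 L'; lra.
have fL x y v : U v -> `|f x v - f y v| <= L * `|x - y|.
  move=> Uv; have /= := fL' v Uv (x, y) (conj I I) => /le_trans; apply.
  by rewrite ler_wpM2r// /L; have := ler_norm L'; lra.
have gE y v : U v -> g y v = colsub sigma (f (zero_extend y) v).
  by move=> Uv; rewrite fg// colsub_zero_extend.
have gM y v : U v -> `|g y v| <= M.
  by move=> Uv; rewrite gE//; apply: le_trans (colsub_norm_le _) _; exact: fM.
have gL x y v : U v -> `|g x v - g y v| <= L * `|x - y|.
  move=> Uv; rewrite !gE//.
  have -> : colsub sigma (f (zero_extend x) v) - colsub sigma (f (zero_extend y) v) =
    colsub sigma (f (zero_extend x) v - f (zero_extend y) v).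
    by apply/rowP => j; rewrite !mxE.
  apply: le_trans (colsub_norm_le _) _; apply: (le_trans (fL _ _ _ Uv)).
  by rewrite ler_wpM2l ?zero_extend_dist// ltW.
have [x0 x0P] := trajectory_exists fM L0 fL fc cu t0 z.
have : is_trajectory f u t z (trajectory f u t z).
  by apply: (@xgetPex _ (fun=> z) [set x | is_trajectory f u t z x]); exists x0.
move: (trajectory f u t z) => x [xt acx dx].
have px : is_trajectory g u t (colsub sigma z) (fun s => colsub sigma (x s)).
  split; first by rewrite xt.
    exact: abs_continuous_colsub.
  apply: filterS dx => s dx ts; rewrite -fg; last by apply: cu.1; lra.
  by apply: is_derive_colsub; exact: dx.
have py : is_trajectory g u t (colsub sigma z) (trajectory g u t (colsub sigma z)).
  apply: (@xgetPex _ (fun=> colsub sigma z)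
    [set y | is_trajectory g u t (colsub sigma z) y]).
  by exists (fun s => colsub sigma (x s)).
by apply: (trajectory_unique gM L0 gL cu.1 px py); rewrite t0 lexx.
Qed.

End coordinate_projection.

(** * The two subsystems *)

Section subsystem_coordinates.
Variables (n1 n2 nc : nat).

Definition coord1 (j : 'I_(n1 + nc)) : 'I_(n1 + n2 + nc) :=
  match fintype.split j with
  | inl i => lshift nc (lshift n2 i)
  | inr i => rshift (n1 + n2) i
  end.

Definition coord2 (j : 'I_(n2 + nc)) : 'I_(n1 + n2 + nc) :=
  match fintype.split j with
  | inl i => lshift nc (rshift n1 i)
  | inr i => rshift (n1 + n2) i
  end.

Lemma coord1_inj : injective coord1.
Proof.
rewrite /coord1 => i j; case: (split_ordP i) => a ->; case: (split_ordP j) => b ->.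
- by move=> /lshift_inj/lshift_inj ->.
- by move=> /eqP; rewrite eq_lrshift.
- by move=> /eqP; rewrite eq_rlshift.
- by move=> /rshift_inj ->.
Qed.

Lemma coord2_inj : injective coord2.
Proof.
rewrite /coord2 => i j; case: (split_ordP i) => a ->; case: (split_ordP j) => b ->.
- by move=> /lshift_inj/rshift_inj ->.
- by move=> /eqP; rewrite eq_lrshift.
- by move=> /eqP; rewrite eq_rlshift.
- by move=> /rshift_inj ->.
Qed.

Lemma colsub_coord1 (R : realType) (z : 'rV[R]_(n1 + n2 + nc)) :
  colsub coord1 z = row_mx (lsubmx (lsubmx z)) (rsubmx z).
Proof. by apply/rowP => j; rewrite !mxE /coord1; case: (fintype.split j) => i; rewrite !mxE. Qed.

Lemma colsub_coord2 (R : realType) (z : 'rV[R]_(n1 + n2 + nc)) :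
  colsub coord2 z = row_mx (rsubmx (lsubmx z)) (rsubmx z).
Proof. by apply/rowP => j; rewrite !mxE /coord2; case: (fintype.split j) => i; rewrite !mxE. Qed.

End subsystem_coordinates.

Theorem theorem2 (R : realType) (n1 n2 nc nu : nat)
    (hn1 : (0 < n1)%N) (hn2 : (0 < n2)%N)
    (U : set 'rV[R]_nu) (hU : compact U)
    (f : 'rV[R]_(n1 + n2 + nc) -> 'rV[R]_nu -> 'rV[R]_(n1 + n2 + nc))
    (hfc : unif_continuous_field U f)
    (hfb : bounded_field U f)
    (hfl : lipschitz_field U f)
    (f1 : 'rV[R]_n1 -> 'rV[R]_nc -> 'rV[R]_nu -> 'rV[R]_n1)
    (f2 : 'rV[R]_n2 -> 'rV[R]_nc -> 'rV[R]_nu -> 'rV[R]_n2)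
    (fc : 'rV[R]_nc -> 'rV[R]_nu -> 'rV[R]_nc)
    (hdec : decomposes f U f1 f2 fc)
    (T : set 'rV[R]_(n1 + n2 + nc))
    (T1 : set 'rV[R]_(n1 + nc)) (T2 : set 'rV[R]_(n2 + nc))
    (t : R) (ht : t < 0)
    (hT : T = backproj1 T1 `&` backproj2 T2) :
  min_BRS f U T t =
    backproj1 (min_BRS (subsystem f1 fc) U T1 t) `&`
    backproj2 (min_BRS (subsystem f2 fc) U T2 t).
Proof.
have t0 := ltW ht.
have fE z v : U v -> f z v =
    row_mx (row_mx (f1 (lsubmx (lsubmx z)) (rsubmx z) v)
      (f2 (rsubmx (lsubmx z)) (rsubmx z) v)) (fc (rsubmx z) v).
  by move=> Uv; rewrite -hdec// !hsubmxK.
have proj1 u z : controls U t u ->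
    row_mx (lsubmx (lsubmx (trajectory f u t z 0))) (rsubmx (trajectory f u t z 0)) =
    trajectory (subsystem f1 fc) u t (row_mx (lsubmx (lsubmx z)) (rsubmx z)) 0.
  rewrite -!colsub_coord1; apply: trajectory_colsub => //; first exact: coord1_inj.
  move=> y v Uv; rewrite !colsub_coord1 fE// /subsystem.
  by rewrite !(row_mxKl, row_mxKr).
have proj2 u z : controls U t u ->
    row_mx (rsubmx (lsubmx (trajectory f u t z 0))) (rsubmx (trajectory f u t z 0)) =
    trajectory (subsystem f2 fc) u t (row_mx (rsubmx (lsubmx z)) (rsubmx z)) 0.
  rewrite -!colsub_coord2; apply: trajectory_colsub => //; first exact: coord2_inj.
  move=> y v Uv; rewrite !colsub_coord2 fE// /subsystem.
  by rewrite !(row_mxKl, row_mxKr).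
rewrite hT; apply/seteqP; split => z /=.
  move=> zT; split => u cu.
    by rewrite -proj1//; exact: (zT u cu).1.
  by rewrite -proj2//; exact: (zT u cu).2.
move=> [z1 z2] u cu; split.
  by rewrite /backproj1 /= proj1//; exact: z1.
by rewrite /backproj2 /= proj2//; exact: z2.
Qed.
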